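(* Let $\mathcal{D},\mathcal{E},\mathcal{C}$ be categories, $(V,\Delta,\varepsilon)$ a comonad on $\mathcal{D}$, $(W,m^W,u^W)$ a monad on $\mathcal{E}$, $(T,m^T,u^T)$ a monad on $\mathcal{C}$, and $F\colon\mathcal{D}\times\mathcal{E}\to\mathcal{C}$ a functor. The liftings of $F$ to a functor $\mathcal{D}^V\times\mathcal{E}^W\to\mathcal{C}^T$ are in one-to-one correspondence with natural transformations $\nu_{X,Y}\colon TF(VX,Y)\to F(X,WY)$ satisfying the lifting property of $F$ with respect to $(V,W,T)$. More precisely, if $\nu$ satisfies the lifting property and $((X,x),(Y,y))\in\mathcal{D}^V\times\mathcal{E}^W$, then $F(X,Y)$ is equipped with the $T$-action $$\triangleright^\nu_{x,y}=\Big(TF(X,Y)\xrightarrow{TF(x,Y)}TF(VX,Y)\xrightarrow{\nu_{X,Y}}F(X,WY)\xrightarrow{F(X,y)}F(X,Y)\Big),$$ and the action of the lifted functor on morphisms is determined by $F$. Conversely, if the functor lifts, i.e. every pair of (co)actions $x,y$ lifts to an action $\triangleright_{x,y}\colon TF(X,Y)\to F(X,Y)$, then the natural transformation $\nu^{\triangleright}$ satisfying the lifting property is obtained as the composition $$\nu^{\triangleright}_{X,Y}=\Big(TF(VX,Y)\xrightarrow{TF(VX,u^W_Y)}TF(VX,WY)\xrightarrow{\triangleright_{\Delta_X,m^W_Y}}F(VX,WY)\xrightarrow{F(\varepsilon_X,WY)}F(X,WY)\Big).$$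
   Context: $\mathcal{D}^V$ is the category of $V$-coalgebras $(X,x\colon X\to VX)$; $\mathcal{E}^W$, $\mathcal{C}^T$ are the Eilenberg–Moore categories of algebras over the monads $W$, $T$. A lifting of $F$ is a functor $\mathcal{D}^V\times\mathcal{E}^W\to\mathcal{C}^T$ whose composition with the forgetful functor $\mathcal{C}^T\to\mathcal{C}$ equals $F$ precomposed with the forgetful functors. An object in a slot of a functor stands for its identity morphism. A natural transformation $\nu_{X,Y}\colon TF(VX,Y)\to F(X,WY)$ ($X\in\mathcal{D}$, $Y\in\mathcal{E}$) satisfies the lifting property of $F$ with respect to $(V,W,T)$ if for all $X,Y$: - (mixed (co)unitality) $\nu_{X,Y}\circ u^T_{F(VX,Y)}=F(\varepsilon_X,u^W_Y)$; - (mixed (co)multiplicativity) $\nu_{X,Y}\circ m^T_{F(VX,Y)}=F(X,m^W_Y)\circ\nu_{X,WY}\circ T\nu_{VX,Y}\circ T^2F(\Delta_X,Y)$. *)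

(* Defs.v *)
From Stdlib Require Import ProofIrrelevance.

Set Implicit Arguments.
Unset Strict Implicit.
Unset Printing Implicit Defensive.

#[local] Obligation Tactic := intros; simpl.

Declare Scope cat_scope.
Delimit Scope cat_scope with cat.

(** Hom-types carry Leibniz equality, so equality of functors is equality of
    their object maps and of their morphism maps. *)
Record Category := {
  Ob :> Type;
  Hom : Ob -> Ob -> Type;
  idm : forall X, Hom X X;
  comp : forall X Y Z, Hom Y Z -> Hom X Y -> Hom X Z;
  comp_idl : forall X Y (f : Hom X Y), comp (idm Y) f = f;
  comp_idr : forall X Y (f : Hom X Y), comp f (idm X) = f;
  comp_assoc : forall X Y Z S (h : Hom Z S) (g : Hom Y Z) (f : Hom X Y),
    comp h (comp g f) = comp (comp h g) f
}.

Arguments Hom {c} X Y.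
Arguments idm {c} X.
Arguments comp {c X Y Z} g f.
Notation "g ∘ f" := (comp g f) (at level 40, left associativity) : cat_scope.
Open Scope cat_scope.

Record Functor (A B : Category) := {
  fob :> A -> B;
  fmap : forall X Y, Hom X Y -> Hom (fob X) (fob Y);
  fmap_id : forall X, fmap (idm X) = idm (fob X);
  fmap_comp : forall X Y Z (g : Hom Y Z) (f : Hom X Y),
    fmap (g ∘ f) = fmap g ∘ fmap f
}.

Arguments fmap {A B} _ {X Y} _.

Definition functor_id (A : Category) : Functor A A :=
  {| fob := fun X => X;
     fmap := fun X Y f => f;
     fmap_id := fun X => eq_refl;
     fmap_comp := fun X Y Z g f => eq_refl |}.

Program Definition functor_comp (A B C : Category)
    (G : Functor B C) (F : Functor A B) : Functor A C :=
  {| fob := fun X => G (F X);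
     fmap := fun X Y f => fmap G (fmap F f) |}.
Next Obligation. now rewrite !fmap_id. Qed.
Next Obligation. now rewrite !fmap_comp. Qed.

Notation "G ⊚ F" := (functor_comp G F) (at level 40, left associativity) : cat_scope.

Program Definition prod_cat (A B : Category) : Category :=
  {| Ob := (A * B)%type;
     Hom := fun P Q => (Hom (fst P) (fst Q) * Hom (snd P) (snd Q))%type;
     idm := fun P => (idm (fst P), idm (snd P));
     comp := fun P Q R g f => (fst g ∘ fst f, snd g ∘ snd f) |}.
Next Obligation. destruct f; simpl; now rewrite !comp_idl. Qed.
Next Obligation. destruct f; simpl; now rewrite !comp_idr. Qed.
Next Obligation. now rewrite !comp_assoc. Qed.

Notation "A × B" := (prod_cat A B) (at level 40, left associativity) : cat_scope.

(** [hpair f g : (X, Y) --> (X', Y')] in the product category; stating the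
    objects as pairs lets [fmap F (hpair f g)] be typed without annotations. *)
Definition hpair (A B : Category) (X X' : A) (Y Y' : B)
    (f : Hom X X') (g : Hom Y Y') : @Hom (A × B) (X, Y) (X', Y') := (f, g).

Program Definition prod_functor (A B A' B' : Category)
    (F : Functor A A') (G : Functor B B') : Functor (A × B) (A' × B') :=
  {| fob := fun P => (F (fst P), G (snd P)) : A' × B';
     fmap := fun P Q h => hpair (fmap F (fst h)) (fmap G (snd h)) |}.
Next Obligation. now unfold hpair; rewrite !fmap_id. Qed.
Next Obligation. now unfold hpair; rewrite !fmap_comp. Qed.

Record NatTrans (A B : Category) (F G : Functor A B) := {
  ncomp :> forall X, Hom (F X) (G X);
  naturality : forall X Y (f : Hom X Y),
    fmap G f ∘ ncomp X = ncomp Y ∘ fmap F f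
}.

Record Monad (C : Category) := {
  mfun :> Functor C C;
  mmult : NatTrans (mfun ⊚ mfun) mfun;
  munit : NatTrans (functor_id C) mfun;
  mmult_assoc : forall X,
    mmult X ∘ fmap mfun (mmult X) = mmult X ∘ mmult (mfun X);
  mmult_unitl : forall X, mmult X ∘ munit (mfun X) = idm (mfun X);
  mmult_unitr : forall X, mmult X ∘ fmap mfun (munit X) = idm (mfun X)
}.

Record Comonad (D : Category) := {
  wfun :> Functor D D;
  wcomult : NatTrans wfun (wfun ⊚ wfun);
  wcounit : NatTrans wfun (functor_id D);
  wcomult_coassoc : forall X,
    fmap wfun (wcomult X) ∘ wcomult X = wcomult (wfun X) ∘ wcomult X;
  wcomult_counitl : forall X, wcounit (wfun X) ∘ wcomult X = idm (wfun X);
  wcomult_counitr : forall X, fmap wfun (wcounit X) ∘ wcomult X = idm (wfun X)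
}.

Section EilenbergMoore.

Variables (C : Category) (T : Monad C).

Definition is_action (X : C) (a : Hom (T X) X) : Prop :=
  a ∘ munit T X = idm X /\ a ∘ fmap T a = a ∘ mmult T X.

Record Algebra := {
  alg_ob : C;
  alg_act : Hom (T alg_ob) alg_ob;
  alg_ax : is_action alg_act
}.

Definition alg_hom (A B : Algebra) : Type :=
  {f : Hom (alg_ob A) (alg_ob B) | f ∘ alg_act A = alg_act B ∘ fmap T f}.

Lemma alg_hom_eq (A B : Algebra) (f g : alg_hom A B) :
  proj1_sig f = proj1_sig g -> f = g.
Proof. intro e; apply eq_sig_hprop; [intros; apply proof_irrelevance | exact e]. Qed.

Program Definition alg_id (A : Algebra) : alg_hom A A := idm (alg_ob A).
Next Obligation. now rewrite fmap_id, comp_idl, comp_idr. Qed.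

Program Definition alg_comp (A B D : Algebra) (g : alg_hom B D) (f : alg_hom A B)
  : alg_hom A D := proj1_sig g ∘ proj1_sig f.
Next Obligation.
destruct g as [g Hg], f as [f Hf]; simpl.
now rewrite fmap_comp, <- comp_assoc, Hf, comp_assoc, Hg, comp_assoc.
Qed.

Program Definition alg_cat : Category :=
  {| Ob := Algebra; Hom := alg_hom; idm := alg_id; comp := alg_comp |}.
Next Obligation. apply alg_hom_eq, comp_idl. Qed.
Next Obligation. apply alg_hom_eq, comp_idr. Qed.
Next Obligation. apply alg_hom_eq, comp_assoc. Qed.

Definition alg_forget : Functor alg_cat C :=
  {| fob := alg_ob : alg_cat -> C;
     fmap := fun (A B : alg_cat) (f : Hom A B) => proj1_sig f;
     fmap_id := fun A => eq_refl;
     fmap_comp := fun A B D g f => eq_refl |}.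

Program Definition free_alg (X : C) : Algebra :=
  {| alg_ob := T X; alg_act := mmult T X |}.
Next Obligation. split; [apply mmult_unitl | apply mmult_assoc]. Qed.

End EilenbergMoore.

Section CoEilenbergMoore.

Variables (D : Category) (V : Comonad D).

Definition is_coaction (X : D) (x : Hom X (V X)) : Prop :=
  wcounit V X ∘ x = idm X /\ fmap V x ∘ x = wcomult V X ∘ x.

Record Coalgebra := {
  coalg_ob : D;
  coalg_act : Hom coalg_ob (V coalg_ob);
  coalg_ax : is_coaction coalg_act
}.

Definition coalg_hom (A B : Coalgebra) : Type :=
  {f : Hom (coalg_ob A) (coalg_ob B) | coalg_act B ∘ f = fmap V f ∘ coalg_act A}.

Lemma coalg_hom_eq (A B : Coalgebra) (f g : coalg_hom A B) :
  proj1_sig f = proj1_sig g -> f = g.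
Proof. intro e; apply eq_sig_hprop; [intros; apply proof_irrelevance | exact e]. Qed.

Program Definition coalg_id (A : Coalgebra) : coalg_hom A A := idm (coalg_ob A).
Next Obligation. now rewrite fmap_id, comp_idl, comp_idr. Qed.

Program Definition coalg_comp (A B E : Coalgebra)
    (g : coalg_hom B E) (f : coalg_hom A B) : coalg_hom A E :=
  proj1_sig g ∘ proj1_sig f.
Next Obligation.
destruct g as [g Hg], f as [f Hf]; simpl.
now rewrite fmap_comp, comp_assoc, Hg, <- comp_assoc, Hf, comp_assoc.
Qed.

Program Definition coalg_cat : Category :=
  {| Ob := Coalgebra; Hom := coalg_hom; idm := coalg_id; comp := coalg_comp |}.
Next Obligation. apply coalg_hom_eq, comp_idl. Qed.
Next Obligation. apply coalg_hom_eq, comp_idr. Qed.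
Next Obligation. apply coalg_hom_eq, comp_assoc. Qed.

Definition coalg_forget : Functor coalg_cat D :=
  {| fob := coalg_ob : coalg_cat -> D;
     fmap := fun (A B : coalg_cat) (f : Hom A B) => proj1_sig f;
     fmap_id := fun A => eq_refl;
     fmap_comp := fun A B E g f => eq_refl |}.

Program Definition cofree_coalg (X : D) : Coalgebra :=
  {| coalg_ob := V X; coalg_act := wcomult V X |}.
Next Obligation. split; [apply wcomult_counitl | apply wcomult_coassoc]. Qed.

End CoEilenbergMoore.

Section Liftings.

Variables (D E C : Category) (V : Comonad D) (W : Monad E) (T : Monad C).
Variable F : Functor (D × E) C.

Record Lifting := {
  lift_functor :> Functor (coalg_cat V × alg_cat W) (alg_cat T);
  lift_spec : alg_forget T ⊚ lift_functor
              = F ⊚ prod_functor (coalg_forget V) (alg_forget W)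
}.

(** The carrier of [L (A, B)] is only propositionally equal to
    [F (coalg_ob A, alg_ob B)], so its action is transported along [lift_spec]. *)
Definition lifted_action (L : Lifting) (A : Coalgebra V) (B : Algebra W) :
    Hom (T (F (coalg_ob A, alg_ob B))) (F (coalg_ob A, alg_ob B)) :=
  eq_rect (alg_forget T ⊚ L)
    (fun P : Functor (coalg_cat V × alg_cat W) C => Hom (T (P (A, B))) (P (A, B)))
    (alg_act (L (A, B)))
    (F ⊚ prod_functor (coalg_forget V) (alg_forget W))
    (lift_spec L).

Definition mixed_transf : Type :=
  NatTrans (T ⊚ F ⊚ prod_functor V (functor_id E))
           (F ⊚ prod_functor (functor_id D) W).

Definition mixed_component (nu : mixed_transf) (X : D) (Y : E) :
  Hom (T (F (V X, Y))) (F (X, W Y)) := nu (X, Y).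

Definition mixed_unitality (nu : mixed_transf) : Prop :=
  forall X Y,
    mixed_component nu X Y ∘ munit T (F (V X, Y))
    = fmap F (hpair (wcounit V X) (munit W Y)).

Definition mixed_multiplicativity (nu : mixed_transf) : Prop :=
  forall X Y,
    mixed_component nu X Y ∘ mmult T (F (V X, Y))
    = fmap F (hpair (idm X) (mmult W Y))
      ∘ mixed_component nu X (W Y)
      ∘ fmap T (mixed_component nu (V X) Y)
      ∘ fmap T (fmap T (fmap F (hpair (wcomult V X) (idm Y)))).

Definition lifting_property (nu : mixed_transf) : Prop :=
  mixed_unitality nu /\ mixed_multiplicativity nu.

Definition LiftingTransf : Type := {nu : mixed_transf | lifting_property nu}.

Definition action_of_transf (nu : mixed_transf) (A : Coalgebra V) (B : Algebra W) :
    Hom (T (F (coalg_ob A, alg_ob B))) (F (coalg_ob A, alg_ob B)) :=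
  fmap F (hpair (idm (coalg_ob A)) (alg_act B))
  ∘ mixed_component nu (coalg_ob A) (alg_ob B)
  ∘ fmap T (fmap F (hpair (coalg_act A) (idm (alg_ob B)))).

Definition transf_of_lifting (L : Lifting) (X : D) (Y : E) :
    Hom (T (F (V X, Y))) (F (X, W Y)) :=
  fmap F (hpair (wcounit V X) (idm (W Y)))
  ∘ lifted_action L (cofree_coalg V X) (free_alg W Y)
  ∘ fmap T (fmap F (hpair (idm (V X)) (munit W Y))).

End Liftings.

Arguments lifting_property {D E C V W T F} nu.
Arguments lifted_action {D E C V W T F} L A B.
Arguments action_of_transf {D E C V W T F} nu A B.
Arguments transf_of_lifting {D E C V W T F} L X Y.

(* Main.v *)
From Stdlib Require Import FunctionalExtensionality ProofIrrelevance.
Require Import Defs.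

(** A lifting of [F] changes nothing but adds, to each object [F (X, Y)], a
    [T]-action natural in the coalgebra [(X, x)] and the algebra [(Y, y)]; so
    liftings are the same as natural families of actions on the functor
    [F ⊚ (U × U)] ([alg_functor_actions_of_functor],
    [actions_of_functor_alg_functor]).  It remains to match such families [α]
    with transformations [ν].  Given [ν], the family is [action_of_transf]: the
    unit law of the action is mixed unitality; its associativity is mixed
    multiplicativity, once the laws of [x] and [y] have turned [Vx ∘ x] into
    [Δ ∘ x] and [y ∘ Wy] into [y ∘ m].  Given [α], its value at the cofree
    coalgebra [V X] and the free algebra [W Y] already carries everything,
    because [x : X -> V X] and [y : W Y -> Y] are morphisms of coalgebras and of
    algebras, split by [ε] and by the unit of [W] in the underlying categories.
    Naturality of [α] along these two morphisms recovers [α] from the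
    transformation ([action_of_transf_of_actions]), and naturality along
    [Δ : V X -> V V X] and [m : W W Y -> W Y] yields mixed multiplicativity.

    Equality of liftings is Leibniz equality of functors, and the action of a
    lifting is transported along its equation.  Both are settled on natural
    families of actions, where equality is pointwise. *)

Set Implicit Arguments.
Unset Strict Implicit.
Unset Printing Implicit Defensive.

Open Scope cat_scope.

(** * Rewriting in composites *)

(** Composites are kept associated to the left, where a redex [g ∘ f] that is
    not at the head occurs only as [h ∘ g ∘ f]. *)
Lemma comp_precomp (C : Category) (X Y Z S : C) (g : Hom Y Z) (f : Hom X Y)
    (k : Hom X Z) (e : g ∘ f = k) (h : Hom Z S) :
  h ∘ g ∘ f = h ∘ k.
Proof. now rewrite <- comp_assoc, e. Qed.

(** The objects hidden in a composite come out of the components of natural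
    transformations as values of identity and composite functors; they are
    computed so that rewriting compares equal expressions. *)
Ltac compute_objects :=
  cbn [fob functor_id functor_comp prod_functor fst snd] in *.

Ltac step E :=
  let e := fresh in
  pose proof E as e; compute_objects;
  first [rewrite e | rewrite (comp_precomp e)]; clear e; rewrite ?comp_assoc;
  compute_objects.

Lemma fmap_hpair_comp (A B C : Category) (F : Functor (A × B) C)
    (X X' X'' : A) (Y Y' Y'' : B)
    (g : Hom X' X'') (g' : Hom Y' Y'') (f : Hom X X') (f' : Hom Y Y') :
  fmap F (hpair g g') ∘ fmap F (hpair f f') = fmap F (hpair (g ∘ f) (g' ∘ f')).
Proof. now rewrite <- fmap_comp. Qed.

Lemma fmap_hpair_id (A B C : Category) (F : Functor (A × B) C) (X : A) (Y : B) :
  fmap F (hpair (idm X) (idm Y)) = idm (F (X, Y)).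
Proof. exact (fmap_id F (X, Y)). Qed.

Lemma fmap_square (A B : Category) (F : Functor A B) (X Y Y' Z : A)
    (g : Hom Y Z) (f : Hom X Y) (g' : Hom Y' Z) (f' : Hom X Y') :
  g ∘ f = g' ∘ f' -> fmap F g ∘ fmap F f = fmap F g' ∘ fmap F f'.
Proof. intro e; now rewrite <- !fmap_comp, e. Qed.

(** * Equality of functors and of transformations *)

Lemma functor_eq (A B : Category) (o : A -> B)
    (m m' : forall X Y, Hom X Y -> Hom (o X) (o Y)) i i' c c' :
  (forall X Y (f : Hom X Y), m X Y f = m' X Y f) ->
  @Build_Functor A B o m i c = @Build_Functor A B o m' i' c'.
Proof.
intro e.
assert (E : m = m') by
  (do 2 (apply functional_extensionality_dep; intro);
   apply functional_extensionality; intro; apply e).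
destruct E; f_equal; apply proof_irrelevance.
Qed.

Lemma nattrans_eq (A B : Category) (F G : Functor A B) (s t : NatTrans F G) :
  (forall X, s X = t X) -> s = t.
Proof.
destruct s as [s ns], t as [t nt]; simpl; intro e.
assert (E : s = t) by (apply functional_extensionality_dep; exact e).
destruct E; f_equal; apply proof_irrelevance.
Qed.

(** * Functors into algebras are natural families of actions *)

Section FunctorsIntoAlgebras.

Variables (A C : Category) (T : Monad C).

Record NaturalActions (H : Functor A C) := {
  act_at :> forall P, Hom (T (H P)) (H P);
  act_at_ax : forall P, is_action (act_at P);
  act_at_nat : forall P Q (f : Hom P Q),
    fmap H f ∘ act_at P = act_at Q ∘ fmap T (fmap H f)
}.

Lemma natural_actions_eq (H : Functor A C) (a b : NaturalActions H) :
  (forall P, a P = b P) -> a = b.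
Proof.
destruct a as [a ax an], b as [b bx bn]; simpl; intro e.
assert (E : a = b) by (apply functional_extensionality_dep; exact e).
destruct E; f_equal; apply proof_irrelevance.
Qed.

Definition alg_functor (H : Functor A C) (a : NaturalActions H) :
    Functor A (alg_cat T).
Proof.
refine (@Build_Functor A (alg_cat T)
  (fun P => {| alg_ob := H P; alg_act := a P; alg_ax := act_at_ax a P |})
  (fun P Q f => exist _ (fmap H f) (act_at_nat a f)) _ _).
- intro P; apply alg_hom_eq, fmap_id.
- intros P Q R g f; apply alg_hom_eq, fmap_comp.
Defined.

Lemma forget_alg_functor (H : Functor A C) (a : NaturalActions H) :
  alg_forget T ⊚ alg_functor a = H.
Proof. destruct H; now apply functor_eq. Qed.

Definition transported_action (K : Functor A (alg_cat T)) (H : Functor A C)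
    (e : alg_forget T ⊚ K = H) (P : A) : Hom (T (H P)) (H P) :=
  eq_rect (alg_forget T ⊚ K) (fun G : Functor A C => Hom (T (G P)) (G P))
    (alg_act (K P)) H e.

Definition actions_of_functor (K : Functor A (alg_cat T)) (H : Functor A C)
    (e : alg_forget T ⊚ K = H) : NaturalActions H.
Proof.
refine {| act_at := transported_action e |}; destruct e; simpl.
- intro P; exact (alg_ax (K P)).
- intros P Q f; exact (proj2_sig (fmap K f)).
Defined.

(** The transport is along an equation of functors, whereas the two sides agree
    on objects by computation; passing to pairs of an object with an action on
    it makes the transport disappear. *)
Lemma actions_of_functor_alg_functor (H : Functor A C) (a : NaturalActions H)
    (e : alg_forget T ⊚ alg_functor a = H) (P : A) :
  transported_action e P = a P.
Proof.
assert (S : forall (K : Functor A (alg_cat T)) G (e : alg_forget T ⊚ K = G),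
  existT (fun X => Hom (T X) X) (G P) (transported_action e P)
  = existT (fun X => Hom (T X) X) (alg_ob (K P)) (alg_act (K P)))
  by (intros K G []; reflexivity).
exact (ProofIrrelevanceTheory.EqdepTheory.inj_pair2 _ _ _ _ _ (S _ _ e)).
Qed.

(** An algebra equals the triple of its components only propositionally, so the
    object maps have to be identified before the morphism maps can be compared;
    hence the sigma types. *)
Lemma functor_into_algebras_eq (K K' : Functor A (alg_cat T)) :
  fob K = fob K' ->
  (forall P Q (f : Hom P Q),
     existT (fun o : C * C => Hom (fst o) (snd o))
       (alg_ob (K P), alg_ob (K Q)) (proj1_sig (fmap K f))
     = existT (fun o : C * C => Hom (fst o) (snd o))
       (alg_ob (K' P), alg_ob (K' Q)) (proj1_sig (fmap K' f))) ->
  K = K'.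
Proof.
destruct K as [o m i c], K' as [o' m' i' c']; simpl; intros E e.
destruct E; apply functor_eq; intros P Q f.
apply alg_hom_eq.
exact (ProofIrrelevanceTheory.EqdepTheory.inj_pair2 _ _ _ _ _ (e P Q f)).
Qed.

Lemma alg_functor_actions_of_functor (K : Functor A (alg_cat T))
    (H : Functor A C) (e : alg_forget T ⊚ K = H) :
  alg_functor (actions_of_functor e) = K.
Proof.
destruct e; apply functor_into_algebras_eq; simpl.
- apply functional_extensionality; intro P; simpl.
  generalize (act_at_ax (actions_of_functor (eq_refl (alg_forget T ⊚ K))) P).
  simpl; unfold transported_action; simpl.
  destruct (K P); simpl; intro; f_equal; apply proof_irrelevance.
- reflexivity.
Qed.

End FunctorsIntoAlgebras.

(** * From transformations to actions and back *)

Section LiftingsAndTransformations.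

Variables (D E C : Category) (V : Comonad D) (W : Monad E) (T : Monad C).
Variable F : Functor (D × E) C.

Notation underlying := (F ⊚ prod_functor (coalg_forget V) (alg_forget W)).

Lemma wcomult_nat (X X' : D) (f : Hom X X') :
  fmap V (fmap V f) ∘ wcomult V X = wcomult V X' ∘ fmap V f.
Proof. exact (naturality (wcomult V) f). Qed.

Lemma wcounit_nat (X X' : D) (f : Hom X X') :
  f ∘ wcounit V X = wcounit V X' ∘ fmap V f.
Proof. exact (naturality (wcounit V) f). Qed.

Lemma mmult_nat (B : Category) (M : Monad B) (Y Y' : B) (g : Hom Y Y') :
  fmap M g ∘ mmult M Y = mmult M Y' ∘ fmap M (fmap M g).
Proof. exact (naturality (mmult M) g). Qed.

Lemma munit_nat (B : Category) (M : Monad B) (Y Y' : B) (g : Hom Y Y') :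
  fmap M g ∘ munit M Y = munit M Y' ∘ g.
Proof. exact (naturality (munit M) g). Qed.

Section ActionsFromTransformation.

Variable nu : mixed_transf V W T F.

Lemma mixed_component_nat (X X' : D) (Y Y' : E) (f : Hom X X') (g : Hom Y Y') :
  fmap F (hpair f (fmap W g)) ∘ mixed_component nu X Y
  = mixed_component nu X' Y' ∘ fmap T (fmap F (hpair (fmap V f) g)).
Proof. exact (naturality nu (hpair f g)). Qed.

(** Naturality in one variable is stated with [idm] in place of [fmap W idm] and
    [fmap V idm], the form in which it meets the other factors of a composite. *)
Lemma mixed_component_natl (X X' : D) (Y : E) (f : Hom X X') :
  fmap F (hpair f (idm (W Y))) ∘ mixed_component nu X Y
  = mixed_component nu X' Y ∘ fmap T (fmap F (hpair (fmap V f) (idm Y))).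
Proof. now rewrite <- mixed_component_nat, fmap_id. Qed.

Lemma mixed_component_natr (X : D) (Y Y' : E) (g : Hom Y Y') :
  fmap F (hpair (idm X) (fmap W g)) ∘ mixed_component nu X Y
  = mixed_component nu X Y' ∘ fmap T (fmap F (hpair (idm (V X)) g)).
Proof. now rewrite mixed_component_nat, fmap_id. Qed.

Lemma action_of_transf_is_action (A : Coalgebra V) (B : Algebra W) :
  lifting_property nu -> is_action (action_of_transf nu A B).
Proof.
intros [Hunit Hmult].
destruct A as [X x [x1 x2]], B as [Y y [y1 y2]].
unfold action_of_transf; simpl in *; compute_objects; split.
- step (munit_nat T (fmap F (hpair x (idm Y)))).
  step (Hunit X Y).
  rewrite !fmap_hpair_comp, !comp_idl, comp_idr, x1, y1.
  apply fmap_hpair_id.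
- (* Everything moves outwards past [ν], until the redexes of the two
     associativity laws are adjacent. *)
  rewrite !fmap_comp, !comp_assoc.
  assert (e1 : fmap T (fmap F (hpair x (idm Y)))
                 ∘ fmap T (fmap F (hpair (idm X) y))
               = fmap T (fmap F (hpair (idm (V X)) y))
                 ∘ fmap T (fmap F (hpair x (idm (W Y)))))
    by (apply fmap_square; now rewrite !fmap_hpair_comp, !comp_idl, !comp_idr).
  step e1.
  step (eq_sym (mixed_component_natr X y)).
  step (fmap_square T (mixed_component_natl Y x)).
  assert (e2 : fmap T (fmap T (fmap F (hpair (fmap V x) (idm Y))))
                 ∘ fmap T (fmap T (fmap F (hpair x (idm Y))))
               = fmap T (fmap T (fmap F (hpair (wcomult V X) (idm Y))))
                 ∘ fmap T (fmap T (fmap F (hpair x (idm Y)))))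
    by (do 2 apply fmap_square; now rewrite !fmap_hpair_comp, x2).
  step e2.
  assert (e3 : fmap F (hpair (idm X) y) ∘ fmap F (hpair (idm X) (fmap W y))
               = fmap F (hpair (idm X) y)
                 ∘ fmap F (hpair (idm X) (mmult W Y)))
    by now rewrite !fmap_hpair_comp, y2.
  step e3.
  step (mmult_nat T (fmap F (hpair x (idm Y)))).
  step (Hmult X Y).
  reflexivity.
Qed.

Lemma action_of_transf_nat (A A' : Coalgebra V) (B B' : Algebra W)
    (f : coalg_hom A A') (g : alg_hom B B') :
  fmap F (hpair (proj1_sig f) (proj1_sig g)) ∘ action_of_transf nu A B
  = action_of_transf nu A' B'
    ∘ fmap T (fmap F (hpair (proj1_sig f) (proj1_sig g))).
Proof.
destruct f as [f Hf], g as [g Hg]; unfold action_of_transf; simpl.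
rewrite !comp_assoc, fmap_hpair_comp, Hg, comp_idr.
assert (e : fmap F (hpair f (alg_act B' ∘ fmap W g))
            = fmap F (hpair (idm (coalg_ob A')) (alg_act B'))
              ∘ fmap F (hpair f (fmap W g)))
  by now rewrite fmap_hpair_comp, comp_idl.
rewrite e.
step (mixed_component_nat f g).
rewrite <- !(comp_assoc _ (fmap T _) (fmap T _)), <- !(fmap_comp T).
compute_objects; now rewrite !fmap_hpair_comp, Hf, !comp_idl, !comp_idr.
Qed.

End ActionsFromTransformation.

Definition actions_of_transf (nu : LiftingTransf V W T F) :
    NaturalActions T underlying :=
  {| act_at := fun P : coalg_cat V × alg_cat W =>
       action_of_transf (proj1_sig nu) (fst P) (snd P)
       : Hom (T (underlying P)) (underlying P);
     act_at_ax := fun P =>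
       action_of_transf_is_action (fst P) (snd P) (proj2_sig nu);
     act_at_nat := fun P Q f =>
       action_of_transf_nat (proj1_sig nu) (fst f) (snd f) |}.

Section TransformationFromActions.

Variable a : NaturalActions T underlying.

Definition action_on (A : Coalgebra V) (B : Algebra W) :
    Hom (T (F (coalg_ob A, alg_ob B))) (F (coalg_ob A, alg_ob B)) :=
  a (A, B).

Lemma action_on_nat (A A' : Coalgebra V) (B B' : Algebra W)
    (f : Hom (coalg_ob A) (coalg_ob A')) (g : Hom (alg_ob B) (alg_ob B')) :
  coalg_act A' ∘ f = fmap V f ∘ coalg_act A ->
  g ∘ alg_act B = alg_act B' ∘ fmap W g ->
  fmap F (hpair f g) ∘ action_on A B
  = action_on A' B' ∘ fmap T (fmap F (hpair f g)).
Proof.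
intros Hf Hg.
exact (act_at_nat a (hpair (A := coalg_cat V) (B := alg_cat W)
  (exist _ f Hf : @Hom (coalg_cat V) A A')
  (exist _ g Hg : @Hom (alg_cat W) B B'))).
Qed.

Lemma action_on_natl (A A' : Coalgebra V) (B : Algebra W)
    (f : Hom (coalg_ob A) (coalg_ob A')) :
  coalg_act A' ∘ f = fmap V f ∘ coalg_act A ->
  fmap F (hpair f (idm (alg_ob B))) ∘ action_on A B
  = action_on A' B ∘ fmap T (fmap F (hpair f (idm (alg_ob B)))).
Proof.
intro Hf; apply action_on_nat; trivial.
now rewrite fmap_id, comp_idl, comp_idr.
Qed.

Lemma action_on_natr (A : Coalgebra V) (B B' : Algebra W)
    (g : Hom (alg_ob B) (alg_ob B')) :
  g ∘ alg_act B = alg_act B' ∘ fmap W g ->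
  fmap F (hpair (idm (coalg_ob A)) g) ∘ action_on A B
  = action_on A B' ∘ fmap T (fmap F (hpair (idm (coalg_ob A)) g)).
Proof.
intro Hg; apply action_on_nat; trivial.
now rewrite fmap_id, comp_idl, comp_idr.
Qed.

Definition free_component (X : D) (Y : E) : Hom (T (F (V X, Y))) (F (X, W Y)) :=
  fmap F (hpair (wcounit V X) (idm (W Y)))
  ∘ action_on (cofree_coalg V X) (free_alg W Y)
  ∘ fmap T (fmap F (hpair (idm (V X)) (munit W Y))).

(** [V f] and [W g] are morphisms between the cofree coalgebras and the free
    algebras, and [ε] and the unit of [W] are natural. *)
Lemma free_component_nat (X X' : D) (Y Y' : E) (f : Hom X X') (g : Hom Y Y') :
  fmap F (hpair f (fmap W g)) ∘ free_component X Y
  = free_component X' Y' ∘ fmap T (fmap F (hpair (fmap V f) g)).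
Proof.
unfold free_component.
rewrite !comp_assoc, fmap_hpair_comp, wcounit_nat, comp_idr.
rewrite <- (comp_idl (fmap W g)), <- fmap_hpair_comp.
assert (e : fmap F (hpair (fmap V f) (fmap W g))
              ∘ action_on (cofree_coalg V X) (free_alg W Y)
            = action_on (cofree_coalg V X') (free_alg W Y')
              ∘ fmap T (fmap F (hpair (fmap V f) (fmap W g)))).
{ apply (@action_on_nat (cofree_coalg V X) (cofree_coalg V X')
           (free_alg W Y) (free_alg W Y')).
  - symmetry; apply wcomult_nat.
  - apply mmult_nat. }
step e.
rewrite <- !(comp_assoc _ (fmap T _) (fmap T _)), <- !(fmap_comp T).
compute_objects; rewrite !fmap_hpair_comp, !comp_idl, !comp_idr.
now step (munit_nat W g).
Qed.

Definition transf_of_actions : mixed_transf V W T F.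
Proof.
refine (@Build_NatTrans _ _ (T ⊚ F ⊚ prod_functor V (functor_id E))
  (F ⊚ prod_functor (functor_id D) W)
  (fun P : D × E => match P with (X, Y) => free_component X Y end) _).
intros [X Y] [X' Y'] [f g]; exact (free_component_nat f g).
Defined.

Lemma free_component_unit (X : D) (Y : E) :
  free_component X Y ∘ munit T (F (V X, Y))
  = fmap F (hpair (wcounit V X) (munit W Y)).
Proof.
unfold free_component.
step (munit_nat T (fmap F (hpair (idm (V X)) (munit W Y)))).
step (proj1 (act_at_ax a (cofree_coalg V X, free_alg W Y))).
simpl; rewrite comp_idr, fmap_hpair_comp.
now rewrite comp_idl, comp_idr.
Qed.

(** Both halves of the right-hand side of mixed multiplicativity collapse to
    the action on [(V X, W Y)]: the outer one along the algebra morphism [m],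
    which cancels the unit of [W]; the inner one along the coalgebra morphism
    [Δ], which cancels [ε]. *)
Lemma free_component_outer (X : D) (Y : E) :
  fmap F (hpair (idm X) (mmult W Y)) ∘ free_component X (W Y)
  = fmap F (hpair (wcounit V X) (idm (W Y)))
    ∘ action_on (cofree_coalg V X) (free_alg W Y).
Proof.
unfold free_component.
rewrite !comp_assoc, fmap_hpair_comp, comp_idl, comp_idr.
rewrite <- (comp_idr (wcounit V X)), <- (comp_idl (mmult W Y)).
rewrite <- fmap_hpair_comp.
assert (e : fmap F (hpair (idm (V X)) (mmult W Y))
              ∘ action_on (cofree_coalg V X) (free_alg W (W Y))
            = action_on (cofree_coalg V X) (free_alg W Y)
              ∘ fmap T (fmap F (hpair (idm (V X)) (mmult W Y)))).
{ apply (@action_on_natr (cofree_coalg V X) (free_alg W (W Y)) (free_alg W Y)).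
  symmetry; apply mmult_assoc. }
step e.
rewrite <- (comp_assoc _ (fmap T _) (fmap T _)), <- fmap_comp, fmap_hpair_comp.
step (mmult_unitl W Y).
now rewrite !comp_idr, fmap_hpair_id, fmap_id, comp_idr.
Qed.

Lemma free_component_inner (X : D) (Y : E) :
  free_component (V X) Y ∘ fmap T (fmap F (hpair (wcomult V X) (idm Y)))
  = action_on (cofree_coalg V X) (free_alg W Y)
    ∘ fmap T (fmap F (hpair (idm (V X)) (munit W Y))).
Proof.
unfold free_component.
assert (e1 : fmap T (fmap F (hpair (idm (V (V X))) (munit W Y)))
               ∘ fmap T (fmap F (hpair (wcomult V X) (idm Y)))
             = fmap T (fmap F (hpair (wcomult V X) (idm (W Y))))
               ∘ fmap T (fmap F (hpair (idm (V X)) (munit W Y))))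
  by (apply fmap_square; now rewrite !fmap_hpair_comp, !comp_idl, !comp_idr).
step e1.
assert (e2 : fmap F (hpair (wcomult V X) (idm (W Y)))
               ∘ action_on (cofree_coalg V X) (free_alg W Y)
             = action_on (cofree_coalg V (V X)) (free_alg W Y)
               ∘ fmap T (fmap F (hpair (wcomult V X) (idm (W Y))))).
{ apply (@action_on_natl (cofree_coalg V X) (cofree_coalg V (V X))
           (free_alg W Y)).
  symmetry; apply wcomult_coassoc. }
step (eq_sym e2).
rewrite fmap_hpair_comp; step (wcomult_counitl V X).
now rewrite comp_idl, fmap_hpair_id, comp_idl.
Qed.

Lemma transf_of_actions_lifting_property : lifting_property transf_of_actions.
Proof.
split; intros X Y; [exact (free_component_unit X Y) |].
change (free_component X Y ∘ mmult T (F (V X, Y))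
  = fmap F (hpair (idm X) (mmult W Y)) ∘ free_component X (W Y)
    ∘ fmap T (free_component (V X) Y)
    ∘ fmap T (fmap T (fmap F (hpair (wcomult V X) (idm Y))))).
rewrite free_component_outer.
rewrite <- (comp_assoc _ (fmap T _) (fmap T _)), <- fmap_comp.
rewrite free_component_inner, fmap_comp, !comp_assoc.
step (proj2 (act_at_ax a (cofree_coalg V X, free_alg W Y))).
step (eq_sym (mmult_nat T (fmap F (hpair (idm (V X)) (munit W Y))))).
reflexivity.
Qed.

Definition lifting_transf_of_actions : LiftingTransf V W T F :=
  exist _ transf_of_actions transf_of_actions_lifting_property.

(** The coaction [x] and the action [y] are themselves morphisms to the cofree
    coalgebra and from the free algebra, with [ε ∘ x = id] and [y ∘ u = id]. *)
Lemma action_of_transf_of_actions (A : Coalgebra V) (B : Algebra W) :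
  action_of_transf transf_of_actions A B = action_on A B.
Proof.
unfold action_of_transf, mixed_component; simpl; unfold free_component.
destruct (coalg_ax A) as [x1 x2], (alg_ax B) as [y1 y2].
set (X := coalg_ob A) in *; set (Y := alg_ob B) in *.
set (x := coalg_act A) in *; set (y := alg_act B) in *.
rewrite !comp_assoc.
assert (e1 : fmap T (fmap F (hpair (idm (V X)) (munit W Y)))
               ∘ fmap T (fmap F (hpair x (idm Y)))
             = fmap T (fmap F (hpair x (idm (W Y))))
               ∘ fmap T (fmap F (hpair (idm X) (munit W Y))))
  by (apply fmap_square; now rewrite !fmap_hpair_comp, !comp_idl, !comp_idr).
step e1.
assert (e2 : fmap F (hpair x (idm (W Y))) ∘ action_on A (free_alg W Y)
             = action_on (cofree_coalg V X) (free_alg W Y)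
               ∘ fmap T (fmap F (hpair x (idm (W Y))))).
{ apply (@action_on_natl A (cofree_coalg V X) (free_alg W Y)).
  symmetry; exact x2. }
step (eq_sym e2).
assert (e3 : fmap F (hpair (idm X) y) ∘ action_on A (free_alg W Y)
             = action_on A B ∘ fmap T (fmap F (hpair (idm X) y))).
{ apply (@action_on_natr A (free_alg W Y) B).
  symmetry; exact y2. }
(* The fusion below has to see one and the same expression for each object. *)
subst X Y x y.
rewrite !fmap_hpair_comp, comp_idl, !comp_idr; step x1.
step e3.
rewrite <- (comp_assoc _ (fmap T _) (fmap T _)), <- fmap_comp, fmap_hpair_comp.
step y1; rewrite comp_idr, fmap_hpair_id, fmap_id.
apply comp_idr.
Qed.

End TransformationFromActions.

(** Naturality of [ν] in the unit of [W] and in [ε] brings the composite to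
    [m ∘ W u = id] and [V ε ∘ Δ = id]. *)
Lemma transf_of_actions_of_transf (nu : LiftingTransf V W T F) :
  lifting_transf_of_actions (actions_of_transf nu) = nu.
Proof.
destruct nu as [nu Hnu].
apply eq_sig_hprop; [intros; apply proof_irrelevance |].
apply nattrans_eq; intros [X Y].
change (free_component (actions_of_transf (exist _ nu Hnu)) X Y
        = mixed_component nu X Y).
unfold free_component, action_on; simpl; unfold action_of_transf; simpl.
rewrite !comp_assoc.
assert (e1 : fmap T (fmap F (hpair (wcomult V X) (idm (W Y))))
               ∘ fmap T (fmap F (hpair (idm (V X)) (munit W Y)))
             = fmap T (fmap F (hpair (idm (V (V X))) (munit W Y)))
               ∘ fmap T (fmap F (hpair (wcomult V X) (idm Y))))
  by (apply fmap_square; now rewrite !fmap_hpair_comp, !comp_idl, !comp_idr).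
step e1.
step (eq_sym (mixed_component_natr nu (V X) (munit W Y))).
rewrite !fmap_hpair_comp, !comp_idr, comp_idl; step (mmult_unitr W Y).
step (mixed_component_natl nu Y (wcounit V X)).
rewrite <- (comp_assoc _ (fmap T _) (fmap T _)), <- fmap_comp, fmap_hpair_comp.
step (wcomult_counitr V X); rewrite comp_idr, fmap_hpair_id, fmap_id.
apply comp_idr.
Qed.

Lemma actions_of_transf_of_actions (a : NaturalActions T underlying) :
  actions_of_transf (lifting_transf_of_actions a) = a.
Proof.
apply natural_actions_eq; intros [A B].
exact (action_of_transf_of_actions a A B).
Qed.

(** * Liftings *)

Definition lifting_of_actions (a : NaturalActions T underlying) :
    Lifting V W T F :=
  {| lift_functor := alg_functor a; lift_spec := forget_alg_functor a |}.

Definition actions_of_lifting (L : Lifting V W T F) :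
    NaturalActions T underlying :=
  actions_of_functor (lift_spec L).

Lemma lifting_of_actions_of_lifting (L : Lifting V W T F) :
  lifting_of_actions (actions_of_lifting L) = L.
Proof.
unfold lifting_of_actions; generalize (forget_alg_functor (actions_of_lifting L)).
unfold actions_of_lifting; rewrite alg_functor_actions_of_functor.
destruct L; simpl; intro; f_equal; apply proof_irrelevance.
Qed.

Lemma actions_of_lifting_of_actions (a : NaturalActions T underlying) :
  actions_of_lifting (lifting_of_actions a) = a.
Proof. apply natural_actions_eq; intro; apply actions_of_functor_alg_functor. Qed.

End LiftingsAndTransformations.

Theorem theoremA2 (D E C : Category) (V : Comonad D) (W : Monad E) (T : Monad C)
    (F : Functor (D × E) C) :
  exists (toTransf : Lifting V W T F -> LiftingTransf V W T F)
         (toLifting : LiftingTransf V W T F -> Lifting V W T F),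
    (forall L : Lifting V W T F, toLifting (toTransf L) = L) /\
    (forall nu : LiftingTransf V W T F, toTransf (toLifting nu) = nu) /\
    (forall (nu : LiftingTransf V W T F) (A : Coalgebra V) (B : Algebra W),
        is_action (action_of_transf (proj1_sig nu) A B) /\
        lifted_action (toLifting nu) A B = action_of_transf (proj1_sig nu) A B) /\
    (forall L L' : Lifting V W T F,
        (forall (A : Coalgebra V) (B : Algebra W),
            lifted_action L A B = lifted_action L' A B) ->
        L = L') /\
    (forall (L : Lifting V W T F) (X : D) (Y : E),
        mixed_component (proj1_sig (toTransf L)) X Y = transf_of_lifting L X Y).
Proof.
exists (fun L => lifting_transf_of_actions (actions_of_lifting L)).
exists (fun nu => lifting_of_actions (actions_of_transf nu)).
split; [| split; [| split; [| split]]].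
- intro L.
  now rewrite actions_of_transf_of_actions, lifting_of_actions_of_lifting.
- intro nu.
  now rewrite actions_of_lifting_of_actions, transf_of_actions_of_transf.
- intros nu A B; split.
  + apply action_of_transf_is_action, (proj2_sig nu).
  + exact (actions_of_functor_alg_functor
             (forget_alg_functor (actions_of_transf nu)) (A, B)).
- intros L L' e.
  rewrite <- (lifting_of_actions_of_lifting L).
  rewrite <- (lifting_of_actions_of_lifting L').
  f_equal; apply natural_actions_eq; intros [A B]; exact (e A B).
- reflexivity.
Qed.
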